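(* Let $X$ and $Y$ be compact Hausdorff spaces equipped with expansive continuous actions of an amenable group $G$. Suppose that the action of $G$ on $X$ has the weak specification property and that $h_{\mathrm{top}}(Y,G) < h_{\mathrm{top}}(X,G)$. Let $f \colon X \to Y$ be a continuous $G$-equivariant map. Then $f$ is not pre-injective. In fact, the restriction of $f$ to any homoclinicity class of $X$ fails to be injective.
   Context: An action of a group $G$ on a topological space $X$ is continuous if $x \mapsto gx$ is continuous for every $g \in G$. A compact Hausdorff space is regarded as a uniform space with its unique compatible uniform structure, whose entourages are the neighborhoods of the diagonal. A group $G$ is amenable if there is a left Følner net, i.e. a net $(F_j)_{j\in J}$ of nonempty finite subsets of $G$ with $\lim_j |gF_j \setminus F_j|/|F_j| = 0$ for all $g \in G$. Expansive: there is an entourage $U_0$ of $X$ such that for all $x \neq y$ in $X$ there is $g \in G$ with $(gx,gy) \notin U_0$. Weak specification property: for every entourage $U$ of $X$ there is a finite subset $\Lambda \subset G$ such that for every finite sequence $\Omega_1,\dots,\Omega_n$ ($n\ge 1$) of finite subsets of $G$ with $\Omega_j \cap \Lambda\Omega_k = \varnothing$ for all distinct $j,k$, and every sequence $x_1,\dots,x_n$ of points of $X$, there is $x \in X$ with $(gx,gx_i) \in U$ for all $g \in \Omega_i$ and $1 \le i \le n$. Two points $x,y\in X$ are homoclinic if for every entourage $U$ of $X$ there is a finite subset $\Omega \subset G$ with $(gx,gy) \in U$ for all $g \in G \setminus \Omega$; this is an equivalence relation, whose classes are the homoclinicity classes. A map $f \colon X \to Y$ is pre-injective if its restriction to each homoclinicity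 class of $X$ is injective. Topological entropy (of a topological space $Z$ with a continuous action of $G$): for a finite open cover $\alpha$ of $Z$, $N(\alpha)$ is the minimal cardinality of a subcover of $\alpha$. For a finite subset $F \subset G$, $\alpha^{(F)} = \bigvee_{g \in F} g^{-1}\alpha$, where $g^{-1}\alpha = \{g^{-1}A : A \in \alpha\}$ and $\alpha \vee \beta = \{A \cap B : A \in \alpha, B \in \beta\}$. Put $h_{\mathrm{top}}(Z,G,\alpha) = \lim_{j} \frac{\log N(\alpha^{(F_j)})}{|F_j|}$ for a left Følner net $(F_j)$ of $G$ (the limit exists and does not depend on the net, by the Ornstein–Weiss lemma), and $h_{\mathrm{top}}(Z,G) = \sup_\alpha h_{\mathrm{top}}(Z,G,\alpha)$ over all finite open covers $\alpha$ of $Z$. *)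

(* Defs.v *)
From HB Require Import structures.
From mathcomp Require Import all_boot all_order all_algebra finmap.
From mathcomp Require Import all_classical all_reals all_analysis.

Set Implicit Arguments.
Unset Strict Implicit.
Unset Printing Implicit Defensive.

Import Order.TTheory GRing.Theory Num.Theory.
Import numFieldNormedType.Exports.

Local Open Scope classical_set_scope.
Local Open Scope ring_scope.

(* A net indexed by [J] is a function on [J] with [directed_set le]; its
   convergence is convergence along the filter [tails le]. *)
Definition directed_set (J : Type) (le : J -> J -> Prop) : Prop :=
  [/\ inhabited J,
      forall i, le i i,
      forall i j k, le i j -> le j k -> le i k &
      forall i j, exists k, le i k /\ le j k].

Definition tails (J : Type) (le : J -> J -> Prop) : set_system J :=
  filter_from setT (fun j => [set k | le j k]).

Definition left_Folner_net (R : realType) (G : groupType) (J : Type)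
    (le : J -> J -> Prop) (F : J -> {fset G}) : Prop :=
  [/\ directed_set le,
      forall j, F j != fset0 &
      forall g : G,
        (#|` [fset (g * h)%g | h in F j] `\` F j|%fset%:R / #|` F j|%:R : R)
          @[j --> tails le] --> (0 : R)].

Definition amenable (R : realType) (G : groupType) : Prop :=
  exists (J : Type) (le : J -> J -> Prop) (F : J -> {fset G}),
    left_Folner_net R le F.

Definition continuous_action (G : groupType) (X : topologicalType)
    (act : G -> X -> X) : Prop :=
  [/\ forall x, act 1%g x = x,
      forall g h x, act (g * h)%g x = act g (act h x) &
      forall g, continuous (act g)].

(* On a compact Hausdorff space these are the entourages of the unique
   compatible uniform structure. *)
Definition diagonal_nbhs (X : topologicalType) : set_system (X * X) :=
  set_nbhs diagonal.

Section Dynamics.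
Variables (G : groupType) (X : topologicalType) (act : G -> X -> X).

Definition expansive : Prop :=
  exists2 U0, diagonal_nbhs U0 &
    forall x y, x <> y -> exists g, ~ U0 (act g x, act g y).

Definition weak_specification : Prop :=
  forall U, diagonal_nbhs U -> exists Lambda : {fset G},
    forall (n : nat) (Omega : 'I_n -> {fset G}) (x_ : 'I_n -> X), (0 < n)%N ->
      (forall j k, j != k ->
        (Omega j `&` [fset (l * w)%g | l in Lambda, w in Omega k] = fset0)%fset) ->
      exists x, forall i g, g \in Omega i -> U (act g x, act g (x_ i)).

Definition homoclinic (x y : X) : Prop :=
  forall U, diagonal_nbhs U -> exists Omega : {fset G},
    forall g, g \notin Omega -> U (act g x, act g y).

Definition homoclinicity_class (x : X) : set X := [set y | homoclinic x y].

Definition pre_injective (Y : Type) (f : X -> Y) : Prop :=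
  forall x, set_inj (homoclinicity_class x) f.

End Dynamics.

Section Entropy.
Variables (G : groupType) (Z : topologicalType) (act : G -> Z -> Z).
Implicit Types alpha beta : {fset (set Z)}.

Definition covering alpha : Prop := \bigcup_(A in [set` alpha]) A = setT.

Definition finite_open_cover alpha : Prop :=
  (forall A, A \in alpha -> open A) /\ covering alpha.

(* [alpha] itself is the starting value of the minimum: this is the minimal
   cardinality of a subcover as soon as [alpha] is a cover. *)
Definition min_subcover alpha : nat :=
  \big[minn/#|` alpha|%fset]_(beta <- fpowerset alpha | `[< covering beta >])
    #|` beta|%fset.

Definition cover_join alpha beta : {fset (set Z)} :=
  [fset (A `&` B)%classic | A in alpha, B in beta]%fset.

Definition cover_translate (g : G) alpha : {fset (set Z)} :=
  [fset (act g^-1%g @` A)%classic | A in alpha]%fset.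

Definition cover_iter (F : {fset G}) alpha : {fset (set Z)} :=
  \big[cover_join/[fset setT]%fset]_(g <- F) cover_translate g alpha.

(* The common limit along all left Folner nets. If [G] is amenable it exists
   (Ornstein-Weiss) and is unique; the default value 0 of [xget] is only used
   otherwise. *)
Definition htop_cover (R : realType) alpha : R :=
  xget 0 [set l : R |
    forall (J : Type) (le : J -> J -> Prop) (F : J -> {fset G}),
      left_Folner_net R le F ->
      ln (min_subcover (cover_iter (F j) alpha))%:R / #|` F j|%fset%:R
        @[j --> tails le] --> l].

Definition htop (R : realType) : \bar R :=
  ereal_sup [set (htop_cover R alpha)%:E | alpha in finite_open_cover].

End Entropy.

(* Main.v *)
Require Import Defs.
From HB Require Import structures.
From mathcomp Require Import all_boot all_order all_algebra finmap.
From mathcomp Require Import all_classical all_reals all_analysis.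
From mathcomp Require Import ring lra.

Set Implicit Arguments.
Unset Strict Implicit.
Unset Printing Implicit Defensive.

Import Order.TTheory GRing.Theory Num.Theory.
Import numFieldNormedType.Exports.

Local Open Scope classical_set_scope.
Local Open Scope ring_scope.

(* Suppose that [f] is injective on the homoclinicity class of [x0]. Given a cover
   [alpha] of [X] and a finite set [F], pick [N(alpha^(F))] points of [X] separated
   along [F]. By specification each of them is followed along [F] by a point which
   stays close to [x0] off a slight thickening [F'] of [F]; by expansiveness these
   points are homoclinic to [x0], so they have distinct images in [Y]. These images
   stay close to [f x0] off [F'], so expansiveness of [Y] separates them along [F'].
   Hence [N(alpha^(F)) <= N(beta^(F'))] for a fixed fine cover [beta] of [Y]. On
   sets [F] that are almost invariant [F'] is negligibly larger than [F], and
   therefore [h(alpha) <= h(beta)].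

   The entropy of a cover is defined as a limit, whose existence is the
   Ornstein-Weiss lemma. Let [b] be the infimum of the upper bounds of [h F / |F|]
   valid on all sufficiently invariant sets. If very invariant sets [T] with
   [h T / |T| < b - eta] existed, covering a fixed proportion of any [F] by almost
   disjoint translates of one such [T] would give an upper bound below [b]. *)

(** * The Ornstein-Weiss lemma *)

Section FiniteSets.
Local Open Scope fset_scope.

Lemma card_fset_le_sum (I : eqType) (K : choiceType) (s : seq I)
    (A : {fset K}) (f : I -> {fset K}) :
  (forall x, x \in A -> exists2 t, t \in s & x \in f t) ->
  (#|` A| <= \sum_(t <- s) #|` f t|)%N.
Proof.
elim: s A => [|t s IHs] A cov.
  rewrite big_nil leqn0 cardfs_eq0; apply/eqP/fsetP => x; rewrite inE.
  by apply/negP => /cov[].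
rewrite big_cons -(cardfsID (f t) A) leq_add ?fsubset_leq_card ?fsubsetIr //.
apply: IHs => x; rewrite inE => /andP[xft /cov[u]].
by rewrite inE => /orP[/eqP-> /(negP xft)//|us xu]; exists u.
Qed.

Lemma card_fset_filter (K : choiceType) (A : {fset K}) (P : pred K) :
  #|` [fset x in A | P x]| = (\sum_(x <- A) P x)%N.
Proof.
rewrite card_fset_sum1 -big_fset_condE [LHS]big_mkcond.
by apply: eq_bigr => i _; case: (P i).
Qed.

End FiniteSets.

Section Translates.
Variable G : groupType.
Local Open Scope fset_scope.
Implicit Types (F S T : {fset G}) (g : G).

Definition ltrans g F : {fset G} := [fset (g * h)%g | h in F].
Definition rtrans F g : {fset G} := [fset (h * g)%g | h in F].

Lemma mem_ltrans g F x : (x \in ltrans g F) = ((g^-1 * x)%g \in F).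
Proof.
apply/imfsetP/idP => [[h /= hF ->]|gx]; first by rewrite mulKg.
by exists (g^-1 * x)%g; rewrite //= mulVKg.
Qed.

Lemma mem_rtrans g F x : (x \in rtrans F g) = ((x * g^-1)%g \in F).
Proof.
apply/imfsetP/idP => [[h /= hF ->]|gx]; first by rewrite mulgK.
by exists (x * g^-1)%g; rewrite //= mulgVK.
Qed.

Lemma card_ltrans g F : #|` ltrans g F| = #|` F|.
Proof. by rewrite card_imfset //; apply: mulgI. Qed.

Lemma card_rtrans g F : #|` rtrans F g| = #|` F|.
Proof. by rewrite card_imfset //; apply: mulIg. Qed.

Lemma card_ltransD g F : #|` F `\` ltrans g F| = #|` ltrans g F `\` F|.
Proof.
apply/eqP; rewrite -(eqn_add2l #|` F `&` ltrans g F|) cardfsID.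
by rewrite fsetIC cardfsID card_ltrans.
Qed.

End Translates.

(** * Almost disjoint translates inside almost invariant sets *)

Section Packing.
Variables (R : realType) (G : groupType).
Implicit Types (F S T K : {fset G}) (g : G).

Definition setprod T S : {fset G} := (\bigcup_(s <- S) rtrans T s)%fset.

Lemma mem_setprod T S x :
  reflect (exists2 s, s \in S & x \in rtrans T s) (x \in setprod T S).
Proof.
by apply: (iffP (bigfcupP _ _ _ _)) => -[s]; rewrite ?andbT; exists s; rewrite ?andbT.
Qed.

(** The pair [(K, d)] measures a degree of invariance. Quantifying over such pairs replaces limits
    along nets, since a left Følner net eventually reaches every degree. *)
Definition invariant K (d : R) F : Prop :=
  F != fset0 /\
  forall k, k \in K -> #|` (ltrans k F `\` F)%fset|%:R <= d * #|` F|%:R.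

Lemma invariantS K K' (d d' : R) F : (K `<=` K')%fset -> d' <= d ->
  invariant K' d' F -> invariant K d F.
Proof.
move=> KK dd [F0 Finv]; split=> // k kK.
by rewrite (le_trans (Finv k _)) ?(fsubsetP KK)// ler_wpM2r.
Qed.

(* Counting the pairs [(t, c)] with [t c] in [A] in two ways. *)
Lemma setI_rtrans_double_count T (C A : {fset G}) :
  (\sum_(c <- C) #|` (rtrans T c `&` A)%fset| <= #|` T| * #|` A|)%N.
Proof.
have rewr c : #|` (rtrans T c `&` A)%fset| = (\sum_(t <- T) ((t * c)%g \in A))%N.
  rewrite -card_fset_filter -[RHS](card_rtrans c); congr (#|` _|).
  apply/fsetP => x; rewrite !(inE, mem_rtrans) /=.
  by rewrite mulgVK.
under eq_bigr do rewrite rewr.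
rewrite exchange_big /= card_fset_sum1 big_distrl /= big_seq [leqRHS]big_seq.
apply: leq_sum => t _; rewrite mul1n -card_fset_filter -(card_ltrans t).
apply/fsubset_leq_card/fsubsetP => x; rewrite mem_ltrans !inE /= => /andP[_].
by rewrite mulVKg.
Qed.

(* A maximal (1 - e)-disjoint family of right translates of [T] inside [F]. *)
Lemma packing F T (e : R) : T != fset0 -> 0 < e -> e <= 1 ->
  exists S : {fset G}, [/\ (setprod T S `<=` F)%fset,
    (1 - e) * (#|` S|%:R * #|` T|%:R) <= #|` setprod T S|%:R &
    e * #|` [fset c in F | (rtrans T c `<=` F)%fset]%fset|%:R
      <= #|` setprod T S|%:R].
Proof.
move=> T0 e0 e1.
pose good S := (setprod T S `<=` F)%fset /\
  (1 - e) * (#|` S|%:R * #|` T|%:R) <= #|` setprod T S|%:R.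
have ex0 : exists n, `[< exists2 S, good S & #|` S| = n >].
  exists 0%N; apply/asboolP; exists fset0; rewrite ?cardfs0 //.
  by rewrite /good /setprod big_seq_fset0 fsub0set cardfs0 mul0r mulr0.
have bnd n : `[< exists2 S, good S & #|` S| = n >] -> (n <= #|` F|)%N.
  (* For [t] in [T] the translate [t S] lies in [setprod T S], hence in [F]; this bounds the size of
     [S]. *)
  move=> /asboolP[S [SF _] <-]; have /fset0Pn[t tT] := T0.
  rewrite -(card_ltrans t S); apply/fsubset_leq_card.
  apply: fsubset_trans SF; apply/fsubsetP => x; rewrite mem_ltrans => xS.
  by apply/mem_setprod; exists (t^-1 * x)%g; rewrite // mem_rtrans invgM invgK mulVKg.
case: (ex_maxnP ex0 bnd) => n /asboolP[S [SF cS] <-] maxS.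
exists S; split => //; set C := [fset c in F | _]%fset; set A := setprod T S.
have Tgt0 : (0 : R) < #|` T|%:R by rewrite ltr0n cardfs_gt0.
(* Each translate inside [F] meets [A] in at least [e |T|] points, since otherwise its centre could
   be added to [S]. *)
have big c : c \in C -> e * #|` T|%:R <= #|` (rtrans T c `&` A)%fset|%:R.
  rewrite !inE => /andP[_ cF].
  case: (boolP (c \in S)) => cS'.
    have -> : (rtrans T c `&` A)%fset = rtrans T c.
      apply/fsetIidPl/fsubsetP => x xc; apply/mem_setprod; by exists c.
    by rewrite card_rtrans ler_piMl.
  rewrite leNgt; apply/negP => small.
  have setU : setprod T (c |` S)%fset = (rtrans T c `|` A)%fset.
    by rewrite /setprod big_fsetU1.
  suff /asboolP/maxS : exists2 S', good S' & #|` S'| = #|` (c |` S)%fset|.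
    by rewrite cardfsU1 cS' add1n ltnn.
  exists (c |` S)%fset => //.
  split; first by rewrite setU fsubUset cF.
  rewrite setU cardfsU1 cS' cardfsU natrB; last first.
    by rewrite (leq_trans (fsubset_leq_card (fsubsetIl _ _))) ?leq_addr.
  rewrite !natrD card_rtrans mulr1n; move: small cS.
  rewrite -/A; set a := #|` A|%:R; set b := #|` (_ `&` A)%fset|%:R.
  set s := #|` S|%:R; set t := #|` T|%:R; nra.
have sumC : #|` C|%:R * (e * #|` T|%:R) <= #|` T|%:R * #|` A|%:R :> R.
  rewrite -natrM (le_trans _ (_ : (\sum_(c <- C) #|` (rtrans T c `&` A)%fset|)%:R <= _))//.
    rewrite natr_sum -sum1_size natr_sum mulr_suml big_seq [leRHS]big_seq.
    by apply: ler_sum => c cC; rewrite mul1r big.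
  by rewrite ler_nat setI_rtrans_double_count.
by rewrite -(ler_pM2l Tgt0) (le_trans _ sumC)// mulrCA mulrA mulrC mulrA.
Qed.

(** If [c] in [F] is not counted, some [t c] with [t] in [T] leaves [F], so [c] lies in a translate
    of [ltrans t F] minus [F]. A union bound over [T] concludes. *)
Lemma card_translates_inside F T K (d : R) : invariant K d F -> (T `<=` K)%fset ->
  #|` F|%:R - #|` T|%:R * (d * #|` F|%:R)
    <= #|` [fset c in F | (rtrans T c `<=` F)%fset]%fset|%:R.
Proof.
move=> [_ Finv] TK; set C := [fset c in F | _]%fset.
have : (#|` (F `\` C)%fset| <= \sum_(t <- T) #|` (ltrans t F `\` F)%fset|)%N.
  under eq_bigr => t _ do rewrite -(card_ltrans t^-1%g).
  apply: card_fset_le_sum => x; rewrite !inE negb_and => /andP[+ xF].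
  rewrite xF /= => /fsubsetPn[y yx yF].
  exists (y * x^-1)%g; first by rewrite mem_rtrans in yx.
  by rewrite mem_ltrans invgK mulgVK inE yF mem_ltrans invgM invgK mulgVK.
rewrite -(ler_nat R) natr_sum.
have : \sum_(t <- T) #|` (ltrans t F `\` F)%fset|%:R <= #|` T|%:R * (d * #|` F|%:R) :> R.
  rewrite -[X in X%:R * _]sum1_size natr_sum mulr_suml big_seq [leRHS]big_seq.
  by apply: ler_sum => t tT; rewrite mul1r Finv// (fsubsetP TK).
have : (C `<=` F)%fset by apply/fsubsetP => x; rewrite !inE => /andP[].
by move=> /fsetIidPr CF; have := cardfsID C F; rewrite CF => /(congr1 (fun n => n%:R : R));
  rewrite natrD; lra.
Qed.

End Packing.

(** * Convergence of subadditive invariant set functions *)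

Section OrnsteinWeiss.
Variables (R : realType) (G : groupType) (h : {fset G} -> R).
Implicit Types (F S T K : {fset G}) (g : G).
Hypothesis h_ge0 : forall F, 0 <= h F.
Hypothesis hU : forall E F, h (E `|` F)%fset <= h E + h F.
Hypothesis h_rtrans : forall F g, h (rtrans F g) = h F.
Variable C : R.
Hypothesis h_lin : forall F, h F <= C * #|` F|%:R.

Definition upper (b : R) : Prop := exists K (d : R),
  0 < d /\ forall F, invariant K d F -> h F <= b * #|` F|%:R.

Lemma h_setprod T S : h (setprod T S) <= #|` S|%:R * h T.
Proof.
have h00 : h fset0 <= 0 by have := h_lin fset0; rewrite cardfs0 mulr0.
rewrite /setprod mulr_natl -iter_addr_0 -count_predT -big_const_seq.
elim: (enum_fset S) => [|s r IHr]; first by rewrite !big_nil; exact: h00.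
by rewrite !big_cons (le_trans (hU _ _))// h_rtrans lerD2l.
Qed.

(** A new boundary point inside [F] is some [t s] whose translate by [k^-1] leaves [setprod T S].
    Then [t] is not in [k T], and [T] minus [k T] has as many points as [k T] minus [T]. *)
Lemma card_ltransD_setprod F S T (k : G) : (setprod T S `<=` F)%fset ->
  (#|` ltrans k (F `\` setprod T S) `\` (F `\` setprod T S)|
   <= #|` ltrans k F `\` F| + #|` S| * #|` ltrans k T `\` T|)%fset%N.
Proof.
move=> SF; set A := setprod T S.
have sub : (ltrans k (F `\` A) `\` (F `\` A) `<=` (ltrans k F `\` F) `|`
    setprod (T `\` ltrans k T) S)%fset.
  apply/fsubsetP => x; rewrite !(inE, mem_ltrans) negb_and negbK.
  case: (boolP (x \in F)) => xF; rewrite ?orbF ?orbT /=; last first.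
    by move=> /andP[_ ->].
  move=> /andP[/mem_setprod[s sS xs] /andP[kxA _]].
  apply/mem_setprod; exists s => //; rewrite mem_rtrans !inE mem_ltrans.
  rewrite -mem_rtrans xs andbT; apply: contra kxA => kxT.
  by apply/mem_setprod; exists s; rewrite // mem_rtrans -mulgA.
apply: leq_trans (fsubset_leq_card sub) _.
rewrite (leq_trans (leq_card_fsetU _ _).1)// leq_add2l.
rewrite (leq_trans (@card_fset_le_sum _ _ S _ (rtrans (T `\` ltrans k T)%fset) _))//.
  by move=> x /mem_setprod.
under eq_bigr do rewrite card_rtrans card_ltransD.
by rewrite big_const_seq count_predT iter_addn_0 mulnC.
Qed.

(* One packing by translates of a very invariant [T] with a small value
   [h T / |T|] improves the upper bound [beta + eta'] by a definite amount: the
   packed part is a definite proportion of [F], and its complement in [F] is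
   either negligible or still invariant. *)
Lemma upper_improve (beta eta e : R) : 0 < eta -> 0 < e -> e <= 1 / 2 ->
  e * beta <= eta / 2 ->
  (forall K (d : R), 0 < d -> exists T : {fset G}, invariant K d T /\
    h T <= (beta - eta) * #|` T|%:R) ->
  upper (beta + eta * e / 8) -> upper (beta - eta * e / 8).
Proof.
move=> eta0 e0 e12 ebeta low [K' [d' [d'0 up]]].
pose C' := `|C| + 1; have C'0 : 0 < C' by rewrite /C' ltr_wpDl.
have hC' F : h F <= C' * #|` F|%:R.
  by rewrite (le_trans (h_lin _))// ler_wpM2r// /C' (le_trans (ler_norm _))// lerDl.
(* Below the proportion [kap] of [F], the linear bound makes the remainder cost at most [eta / 4]
   per point of [F]. *)
pose kap := eta / (4 * C'); have kap0 : 0 < kap by rewrite divr_gt0// mulr_gt0.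
have kapE : C' * kap = eta / 4 by rewrite /kap; field; rewrite gt_eqF.
(* The boundary of the remainder is at most [d1 |F|] coming from [F] plus [2 d1 |F|] coming from the
   translates of [T], hence the factor 3. *)
pose d1 := kap * d' / 3; have d10 : 0 < d1 by rewrite divr_gt0// mulr_gt0.
have [T [[T0 Tinv] hT]] := low K' d1 d10.
have t0 : (0 : R) < #|` T|%:R by rewrite ltr0n cardfs_gt0.
(* The second bound makes at least half of the points of [F] centres of translates of [T] inside
   [F]. *)
pose d2 := Num.min d1 (1 / (2 * #|` T|%:R)).
exists (K' `|` T)%fset, d2; split.
  by rewrite lt_min d10 divr_gt0// mulr_gt0.
move=> F Finv; have [S [SF cS cA]] := @packing R G F T e T0 e0 ltac:(lra).
have f0 : (0 : R) < #|` F|%:R by rewrite ltr0n cardfs_gt0; case: Finv.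
have half := card_translates_inside Finv (fsubsetUr K' T).
set A := setprod T S in cS cA SF; pose B := (F `\` A)%fset.
have td2 : #|` T|%:R * d2 <= 1 / 2.
  by rewrite mulrC -ler_pdivlMr// ge_min invfM mulrA lexx orbT.
have cA' : e * #|` F|%:R / 2 <= #|` A|%:R.
  move: half cA; set c := #|` [fset _ in _ | _]|%fset%:R => half cA.
  have := ler_wpM2r (ltW f0) td2 => tf.
  have /(ler_wpM2l (ltW e0)) : #|` F|%:R / 2 <= c by lra.
  lra.
have cB : #|` B|%:R = #|` F|%:R - #|` A|%:R :> R.
  rewrite /B cardfsDS// natrB// fsubset_leq_card//.
(* The overlaps cost a factor [1 - e], which [e * beta <= eta / 2] absorbs at the price of half of
   [eta]. *)
have hA : h A <= (beta - eta / 2) * #|` A|%:R.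
  apply: le_trans (h_setprod T S) _.
  have := ler_wpM2l (ler0n R #|` S|) hT.
  have hT0 := h_ge0 T.
  have be0 : 0 <= beta - eta by have := le_trans hT0 hT; rewrite pmulr_lge0.
  move: cS t0; set s := #|` S|%:R; set t := #|` T|%:R; set a := #|` A|%:R.
  move=> cS t0; have st0 : 0 <= s * t by rewrite mulr_ge0 ?ler0n.
  have := ler_wpM2l (_ : 0 <= beta - eta / 2) cS => /(_ ltac:(lra)).
  have : (beta - eta) * (s * t) <= (beta - eta / 2) * ((1 - e) * (s * t)).
    rewrite [X in _ <= X]mulrA ler_wpM2r//; nra.
  rewrite mulrCA; lra.
have hF : h F <= h A + h B.
  by rewrite (le_trans _ (hU _ _))// /B fsetUDl fsetDv fsetD0 (fsetUidPr _ _ SF).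
have [Bsmall|Bbig] := ltP #|` B|%:R (kap * #|` F|%:R).
  have : h B <= eta / 4 * #|` F|%:R.
    by rewrite (le_trans (hC' _))// -kapE -mulrA ler_pM2l// ltW.
  have AF : #|` A|%:R <= #|` F|%:R :> R by rewrite ler_nat fsubset_leq_card.
  have be0 : 0 <= beta - eta by have := le_trans (h_ge0 T) hT; rewrite pmulr_lge0.
  have := ler_wpM2l (_ : 0 <= beta - eta / 2) AF => /(_ ltac:(lra)).
  have : (eta * e / 8) * #|` F|%:R <= eta / 16 * #|` F|%:R.
    by rewrite ler_pM2r//; have := ler_wpM2l (ltW eta0) e12; lra.
  have := mulr_gt0 eta0 f0; lra.
have Binv : invariant K' d' B.
  split=> [|k kK].
    by rewrite -cardfs_gt0 -(ltr_nat R) (lt_le_trans _ Bbig)// mulr_gt0.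
  have := @card_ltransD_setprod F S T k SF.
  rewrite -(ler_nat R) natrD natrM => /le_trans; apply.
  have Fk : #|` (ltrans k F `\` F)%fset|%:R <= d1 * #|` F|%:R.
    rewrite (le_trans (Finv.2 k _)) ?inE ?kK//.
    by rewrite ler_wpM2r// ge_min lexx.
  have Tk := ler_wpM2l (ler0n R #|` S|) (Tinv _ kK).
  have AF : #|` A|%:R <= #|` F|%:R :> R by rewrite ler_nat fsubset_leq_card.
  have ST : #|` S|%:R * #|` T|%:R <= 2 * #|` F|%:R :> R.
    have st0 : 0 <= #|` S|%:R * #|` T|%:R :> R by rewrite mulr_ge0.
    by have := ler_wpM2r st0 e12; lra.
  have := ler_wpM2l (ltW d10) ST; rewrite mulrCA.
  have : 3 * (d1 * #|` F|%:R) <= d' * #|` B|%:R.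
    by have := ler_wpM2l (ltW d'0) Bbig; rewrite /d1; lra.
  by rewrite mulrCA; lra.
have hB := up _ Binv; rewrite cB in hB.
(* The gain [eta / 2] on at least [e |F| / 2] points is [eta * e / 4] per point of [F], twice the
   excess [eta * e / 8] allowed on [B]. *)
have := ler_wpM2l (ltW eta0) cA'.
have : 0 <= eta * e * #|` A|%:R by rewrite !mulr_ge0// ltW.
lra.
Qed.

(** The limit is taken over invariant sets and not along one net, so that the same [l] serves all
    Følner nets. *)
Theorem ornstein_weiss :
  (forall K (d : R), 0 < d -> exists F, invariant K d F) ->
  exists l : R, forall e, 0 < e -> exists K (d : R), 0 < d /\
    forall F, invariant K d F -> `|h F / #|` F|%:R - l| <= e.
Proof.
move=> Ginv.
have upper_ge0 b : upper b -> 0 <= b.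
  move=> [K [d [d0 up]]]; have [F Finv] := Ginv K d d0.
  have f0 : (0 : R) < #|` F|%:R by rewrite ltr0n cardfs_gt0; case: Finv.
  by have := le_trans (h_ge0 F) (up _ Finv); rewrite pmulr_lge0.
have hinf : has_inf upper.
  split; last by exists 0 => b /upper_ge0.
  by exists C, fset0, 1; split.
pose l := inf upper; have l0 : 0 <= l.
  by apply: lb_le_inf; [case: hinf | move=> b /upper_ge0].
exists l => eta eta0.
have upl z : 0 < z -> upper (l + z).
  move=> z0; have [b [K [d [d0 up]]] bl] := inf_adherent z0 hinf.
  exists K, d; split => // F /up/le_trans; apply.
  by rewrite ler_wpM2r// ltW.
have [K1 [d1 [d10 up]]] := upl eta eta0.
have [K2 [d2 [d20 low]]] : exists K (d : R), 0 < d /\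
    forall F, invariant K d F -> (l - eta) * #|` F|%:R <= h F.
  apply: contrapT => nlow.
  (* This choice ensures both [e <= 1 / 2] and [e * l <= eta / 2]; the improved bound then falls
     below the infimum [l]. *)
  pose e := eta / (2 * (l + eta + 1)).
  have e0 : 0 < e by rewrite divr_gt0//; lra.
  have eE : e * (2 * (l + eta + 1)) = eta by rewrite /e mulfVK// gt_eqF//; lra.
  have : upper (l - eta * e / 8).
    apply: upper_improve => //.
    - nra.
    - nra.
    - move=> K d d0; apply: contrapT => nT; apply: nlow; exists K, d; split=> // F Finv.
      by rewrite leNgt; apply/negP => lt; apply: nT; exists F; split=> //; exact: ltW.
    - by apply: upl; rewrite divr_gt0// mulr_gt0.
  move=> /(ge_inf hinf.2); rewrite -/l.
  have : 0 < eta * e / 8 by rewrite divr_gt0// mulr_gt0.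
  lra.
exists (K1 `|` K2)%fset, (Num.min d1 d2); split; first by rewrite lt_min d10.
move=> F Finv; have f0 : (0 : R) < #|` F|%:R by rewrite ltr0n cardfs_gt0; case: Finv.
rewrite ler_distl ler_pdivlMr// ler_pdivrMr// low ?up//.
- by apply: invariantS Finv; [exact: fsubsetUl | rewrite ge_min lexx].
- by apply: invariantS Finv; [exact: fsubsetUr | rewrite ge_min lexx orbT].
Qed.

End OrnsteinWeiss.

(** * Entropy of covers *)

Section FolnerNets.
Variables (R : realType) (G : groupType).

Lemma tails_proper (J : Type) (le : J -> J -> Prop) :
  directed_set le -> ProperFilter (tails le).
Proof.
move=> [[j0] lerr letr lub]; apply: filter_from_proper.
  apply: filter_from_filter; first by exists j0.
  move=> i j _ _; have [k [ik jk]] := lub i j; exists k => // m /= km.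
  by split; apply: letr km.
by move=> i _; exists i.
Qed.

Lemma Folner_invariant (J : Type) (le : J -> J -> Prop) (F : J -> {fset G}) :
  left_Folner_net R le F -> forall (K : {fset G}) (d : R), 0 < d ->
  \forall j \near tails le, invariant K d (F j).
Proof.
move=> [dir F0 lim] K d d0; have PF := tails_proper dir.
suff : \forall j \near tails le, forall k, k \in enum_fset K ->
    #|` (ltrans k (F j) `\` F j)%fset|%:R <= d * #|` F j|%:R.
  by apply: filterS => j; split.
elim: (enum_fset K) => [|k s IHs]; first by near=> j.
have fk := cvgr0_norm_le _ (lim k) _ d0.
near=> j => g; rewrite inE => /orP[/eqP ->|gs]; last first.
  by move: g gs; near: j; exact: IHs.
have f0 : (0 : R) < #|` F j|%:R by rewrite ltr0n cardfs_gt0.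
rewrite -ler_pdivrMr//; apply: le_trans (ler_norm _) _.
by near: j; exact: fk.
Unshelve. all: by end_near. Qed.

Lemma amenable_invariant (K : {fset G}) (d : R) :
  0 < d -> amenable R G -> exists F, invariant K d F.
Proof.
move=> d0 [J [le [F FP]]]; have [dir _ _] := FP; have PF := tails_proper dir.
by have /filter_ex[j jP] := Folner_invariant FP K d0; exists (F j).
Qed.

End FolnerNets.

Lemma bigminn_seqP (I : eqType) (s : seq I) (P : pred I) (f : I -> nat) (x : nat)
    (m := \big[minn/x]_(i <- s | P i) f i) :
  (forall i, i \in s -> P i -> (m <= f i)%N) /\
  (m = x \/ exists i, [/\ i \in s, P i & m = f i]).
Proof.
rewrite {}/m; elim: s => [|j s [IH1 IH2]]; first by rewrite big_nil; split; [|left].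
rewrite big_cons; case: ifPn => Pj; last first.
  split=> [i|]; first by rewrite inE => /orP[/eqP->|]; [rewrite (negPf Pj)|exact: IH1].
  by case: IH2 => [|[i [si Pi e]]]; [left|right; exists i; rewrite inE si orbT].
split=> [i|].
  rewrite inE => /orP[/eqP-> _|si Pi]; first exact: geq_minl.
  exact: leq_trans (geq_minr _ _) (IH1 _ si Pi).
rewrite /minn; case: ifP => _; first by right; exists j; rewrite mem_head.
by case: IH2 => [|[i [si Pi e]]]; [left|right; exists i; rewrite inE si orbT].
Qed.

Section LnNat.
Variable R : realType.

(** Since [ln 0] is 0 by default, monotonicity extends to 0, the value that [Ncov] takes on an empty
    space. *)
Lemma ln_nat_le (m n : nat) : (m <= n)%N -> ln m%:R <= ln n%:R :> R.
Proof.
case: m => [|m] mn; last by rewrite ler_ln ?posrE ?ltr0n ?ler_nat// (leq_trans _ mn).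
rewrite (@ln0 _ 0)//; case: n {mn} => [|n]; first by rewrite ln0.
by rewrite ln_ge0// ler1n.
Qed.

Lemma ln_nat_ge0 (n : nat) : 0 <= ln n%:R :> R.
Proof. by have := ln_nat_le (leq0n n); rewrite (@ln0 _ 0%:R). Qed.

Lemma ln_nat_mul_le (m n k : nat) : (k <= m * n)%N ->
  ln k%:R <= ln m%:R + ln n%:R :> R.
Proof.
case: k => [|k] kmn; first by rewrite (@ln0 _ 0%:R)// addr_ge0 ?ln_nat_ge0.
have : (0 < m * n)%N by apply: leq_trans kmn.
rewrite muln_gt0 => /andP[m0 n0].
by rewrite -lnM ?posrE ?ltr0n// -natrM ln_nat_le.
Qed.

End LnNat.

(** * Subadditivity and invariance of the number of sets in a minimal subcover *)

Section CoverCounting.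
Variables (R : realType) (G : groupType) (Z : topologicalType).
Variable act : G -> Z -> Z.
Hypothesis actP : continuous_action act.
Variable alpha : {fset (set Z)}.
Hypothesis alphaP : finite_open_cover alpha.
Implicit Types (E F : {fset G}).

Lemma actK g : cancel (act g) (act g^-1%g).
Proof. by case: actP => act1 actM _ z; rewrite -actM mulVg. Qed.

Lemma actVK g : cancel (act g^-1%g) (act g).
Proof. by case: actP => act1 actM _ z; rewrite -actM mulgV. Qed.

Lemma mem_cover_translate g B : (B \in cover_translate act g alpha) <->
  exists2 A, A \in alpha & B = [set z | A (act g z)].
Proof.
have trE A : act g^-1%g @` A = [set z | A (act g z)].
  apply/seteqP; split=> [_ [z Az <-]|z Az] /=; first by rewrite actVK.
  by exists (act g z); rewrite ?actK.
split=> [/imfsetP[A /= aA ->]|[A aA ->]]; first by exists A.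
by apply/imfsetP; exists A.
Qed.

(** Induction on a duplicate-free enumeration of [F]: the choice at the new element can then be set
    without changing the others. *)
Lemma mem_cover_iter F B : (B \in cover_iter act F alpha) <->
  exists2 a : G -> set Z, (forall g, g \in F -> a g \in alpha) &
    B = [set z | forall g, g \in F -> a g (act g z)].
Proof.
suff H s : uniq s ->
    (B \in \big[@cover_join Z/[fset setT]%fset]_(g <- s) cover_translate act g alpha)
    <-> exists2 a : G -> set Z, (forall g, g \in s -> a g \in alpha) &
    B = [set z | forall g, g \in s -> a g (act g z)].
  exact: (H (enum_fset F) (fset_uniq F)).
elim: s B => [|g s IHs] B.
  rewrite big_nil inE => _; split=> [/eqP ->|[a _ ->]].
    by exists (fun=> setT) => //; apply/seteqP; split.
  by apply/eqP/seteqP; split.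
rewrite big_cons => /= /andP[gs us].
split=> [/imfset2P[A /mem_cover_translate[A0 A0a ->]] [B0 /(IHs _ us)[a aa ->] ->]|].
  exists (fun h => if h == g then A0 else a h).
    move=> h; rewrite inE; case: eqP => //= _; exact: aa.
  apply/seteqP; split => z /=.
    move=> [Az az] h; rewrite inE; case: eqP => [->//|_ /=]; exact: az.
  move=> Az; split; first by have := Az g; rewrite mem_head eqxx; apply.
  move=> h hs; have := Az h; rewrite inE hs orbT => /(_ isT).
  by case: eqP => // hg; move: gs; rewrite -hg hs.
move=> [a aa ->]; apply/imfset2P => /=.
exists [set z | a g (act g z)].
  by apply/mem_cover_translate; exists (a g); rewrite ?aa ?mem_head.
exists [set z | forall h, h \in s -> a h (act h z)].
  by apply/(IHs _ us); exists a => // h hs; rewrite aa// inE hs orbT.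
apply/seteqP; split => z /=.
  by move=> az; split=> [|h hs]; apply: az; rewrite inE ?eqxx ?hs ?orbT.
by move=> [ag az] h; rewrite inE => /orP[/eqP->//|/az].
Qed.

(* A subcover of [alpha^(F)] of cardinality at most [#|I|], given by the members
   of [alpha] that its elements choose at each [g] in [F]. *)
Definition subcover_family (I : finType) (a : I -> G -> set Z) F : Prop :=
  (forall i g, g \in F -> a i g \in alpha) /\
  forall z, exists i, forall g, g \in F -> a i g (act g z).

Definition Ncov F : nat := min_subcover (cover_iter act F alpha).

(** Together with [Ncov_family] this makes [Ncov F] the least size of a subcover family, so later
    bounds only have to build families. *)
Lemma Ncov_le I a F : @subcover_family I a F -> (Ncov F <= #|I|)%N.
Proof.
move=> [aa ca]; pose B i := [set z | forall g, g \in F -> a i g (act g z)].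
pose beta := [fset B i | i in I]%fset.
apply: leq_trans (_ : (#|` beta| <= _)%N); last first.
  by apply: leq_trans (leq_imfset_card _ _ _) _; rewrite cardE.
have [+ _] := @bigminn_seqP _ (fpowerset (cover_iter act F alpha))
  (fun b => `[< covering b >]) (fun b => #|` b|%fset) #|` cover_iter act F alpha|.
apply.
  rewrite fpowersetE; apply/fsubsetP => _ /imfsetP[i /= _ ->].
  by apply/mem_cover_iter; exists (a i) => // g; apply: aa.
apply/asboolP/seteqP; split=> // z _; have [i zi] := ca z.
by exists (B i) => //=; apply/imfsetP; exists i.
Qed.

Lemma covering_cover_iter F : covering (cover_iter act F alpha).
Proof.
apply/seteqP; split=> // z _.
have /choice[a aP] : forall g, exists A, A \in alpha /\ A (act g z).
  move=> g; have [_ cov] := alphaP; have : [set: Z] (act g z) by [].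
  by rewrite -cov => -[A /= Aa Az]; exists A.
exists [set z | forall g, g \in F -> a g (act g z)] => /=.
  by apply/mem_cover_iter; exists a => // g _; case: (aP g).
by move=> g _; case: (aP g).
Qed.

Lemma Ncov_family F : exists a : 'I_(Ncov F) -> G -> set Z, subcover_family a F.
Proof.
have [b [bsub bcov bE]] : exists b, [/\ (b `<=` cover_iter act F alpha)%fset,
    covering b & #|` b| = Ncov F].
  have [_] := @bigminn_seqP _ (fpowerset (cover_iter act F alpha))
    (fun b => `[< covering b >]) (fun b => #|` b|%fset) #|` cover_iter act F alpha|.
  (* If the minimum is its starting value, the whole cover serves as the subcover. *)
  case=> [E|[b []]]; last by rewrite fpowersetE => bs /asboolP bc E; exists b; split => //; exact: esym E.
  by exists (cover_iter act F alpha); split => //; exact: covering_cover_iter.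
have /choice[a aP] : forall i : 'I_(Ncov F), exists a : G -> set Z,
    (forall g, g \in F -> a g \in alpha) /\
    nth set0 b i = [set z | forall g, g \in F -> a g (act g z)].
  move=> i; have /(fsubsetP bsub)/mem_cover_iter[a aa ->] : nth set0 b i \in b.
    by rewrite mem_nth// bE.
  by exists a.
exists a; split=> [i g gF|z]; first by case: (aP i) => /(_ g gF).
have : [set: Z] z by []; rewrite -bcov => -[B /= bB zB].
have iB : (index B b < Ncov F)%N by rewrite -bE index_mem.
exists (Ordinal iB); have [_] := aP (Ordinal iB).
by rewrite nth_index//= => BE; rewrite BE in zB.
Qed.

Lemma NcovU E F : (Ncov (E `|` F)%fset <= Ncov E * Ncov F)%N.
Proof.
have [a [aa ca]] := Ncov_family E; have [b [bb cb]] := Ncov_family F.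
rewrite -[X in (X * _)%N]card_ord -[X in (_ * X)%N]card_ord -card_prod.
apply: (@Ncov_le _ (fun ij g => if g \in E then a ij.1 g else b ij.2 g)).
split=> [[i j] g|z] /=.
  by rewrite inE; case: ifP => [gE _|_ /= gF]; [exact: aa | exact: bb].
have [i iP] := ca z; have [j jP] := cb z; exists (i, j) => g /=.
by rewrite inE; case: ifP => [gE _|_ /= gF]; [exact: iP | exact: jP].
Qed.

(** The family for [F] is pulled back along [act c]: the index of [z] is the one chosen for
    [act c z]. *)
Lemma Ncov_rtrans_le F c : (Ncov (rtrans F c) <= Ncov F)%N.
Proof.
have [a [aa ca]] := Ncov_family F; rewrite -[leqRHS]card_ord.
apply: (@Ncov_le _ (fun i g => a i (g * c^-1)%g)); split=> [i g|z].
  by rewrite mem_rtrans; apply: aa.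
have [i iP] := ca (act c z); exists i => g; rewrite mem_rtrans => /iP.
by case: actP => _ actM _; rewrite -actM mulgVK.
Qed.

Lemma Ncov_rtrans F c : Ncov (rtrans F c) = Ncov F.
Proof.
apply/eqP; rewrite eqn_leq Ncov_rtrans_le /=.
have -> : F = rtrans (rtrans F c) c^-1%g.
  by apply/fsetP => x; rewrite !mem_rtrans invgK mulgK.
rewrite (_ : rtrans (rtrans (rtrans F c) c^-1%g) c = rtrans F c) ?Ncov_rtrans_le//.
by apply/fsetP => x; rewrite !mem_rtrans invgK mulgVK.
Qed.

Lemma Ncov_lin F : (Ncov F <= #|` alpha| ^ #|` F|)%N.
Proof.
suff H n : #|` F| = n -> (Ncov F <= #|` alpha| ^ n)%N by exact: H.
elim: n F => [|n IHn] F.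
  move/eqP; rewrite cardfs_eq0 => /eqP ->; rewrite expn0 -card_unit.
  apply: (@Ncov_le unit (fun _ _ => setT)); split=> [i g|z]; rewrite ?inE//.
move=> cF; have /fset0Pn[g gF] : F != fset0 by rewrite -cardfs_gt0 cF.
rewrite -(fsetD1K gF) expnS; apply: leq_trans (NcovU _ _) _.
apply: leq_mul; last by apply: IHn; move: cF; rewrite (cardfsD1 g) gF add1n => -[].
rewrite cardfE; apply: (@Ncov_le alpha (fun A : alpha => fun=> val A)).
split=> [A h _|z]; first exact: valP.
have : [set: Z] (act g z) by []; case: alphaP => _ <- [A /= Aa zA].
by exists [` Aa]%fset => h; rewrite inE => /eqP ->.
Qed.

Definition hcov F : R := ln (Ncov F)%:R.

Lemma hcov_ge0 F : 0 <= hcov F.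
Proof. exact: ln_nat_ge0. Qed.

Lemma hcovU E F : hcov (E `|` F)%fset <= hcov E + hcov F.
Proof. exact/ln_nat_mul_le/NcovU. Qed.

Lemma hcov_rtrans F c : hcov (rtrans F c) = hcov F.
Proof. by rewrite /hcov Ncov_rtrans. Qed.

Lemma hcov_lin F : hcov F <= ln #|` alpha|%:R * #|` F|%:R.
Proof.
apply: le_trans (ln_nat_le R (Ncov_lin F)) _.
(* For an empty [alpha] the bound on [Ncov] is a power of 0, equal to 1 or 0, and the logarithm is 0
   in both cases. *)
have [->|a0] := posnP #|` alpha|; last by rewrite natrX lnXn ?ltr0n// mulr_natr.
case: #|` F| => [|n]; first by rewrite expn0 ln1 mulr0.
by rewrite exp0n// ln0// mul0r.
Qed.

Lemma htop_cover_invariant : amenable R G -> forall e, 0 < e ->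
  exists K (d : R), 0 < d /\
    forall F, invariant K d F -> `|hcov F / #|` F|%:R - htop_cover act R alpha| <= e.
Proof.
move=> amG.
have [l lP] := ornstein_weiss hcov_ge0 hcovU hcov_rtrans hcov_lin
  (fun K d d0 => amenable_invariant K d0 amG).
suff -> : htop_cover act R alpha = l by exact: lP.
apply: xget_unique.
  move=> J' le' F' F'P; have [dir _ _] := F'P; have PF := tails_proper dir.
  apply/cvgrPdist_le => e e0; have [K [d [d0 KP]]] := lP e e0.
  by apply: filterS (Folner_invariant F'P K d0) => j /KP; rewrite distrC.
have [J [le [F0 F0P]]] := amG.
move=> l' /(_ _ _ _ F0P); have [dir _ _] := F0P; have PF := tails_proper dir.
move=> cv; apply: (cvg_unique _ cv) => //.
apply/cvgrPdist_le => e e0; have [K [d [d0 KP]]] := lP e e0.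
by apply: filterS (Folner_invariant F0P K d0) => j /KP; rewrite distrC.
Qed.

End CoverCounting.

(** * Entourages of compact Hausdorff spaces *)

(** This is the form of compactness used below, mostly by contradiction: the counterexamples to a
    uniform statement form a directed family, and a common adherent point refutes it. *)
Lemma compact_directed_adherent (T : topologicalType) (I : Type) (S : I -> set T) :
  compact [set: T] -> inhabited I -> (forall i, S i !=set0) ->
  (forall i j, exists k, S k `<=` S i `&` S j) ->
  exists x, forall i, closure (S i) x.
Proof.
move=> cT [i0] S0 Sdir.
have PF : ProperFilter (filter_from setT S).
  apply: filter_from_proper => //; apply: filter_from_filter; first by exists i0.
  by move=> i j _ _; have [k] := Sdir i j; exists k.
have [x [_ clx]] := cT _ PF filterT.
by exists x => i B Bx; apply: clx => //; exists i.
Qed.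

Section DiagonalNbhs.
Variable X : topologicalType.
Implicit Types (U V W : set (X * X)) (x y z : X).

Lemma diagonal_nbhsP U : diagonal_nbhs U <-> forall x, nbhs (x, x) U.
Proof.
by split=> [dU x|dU [x y] /= /diagonalP <-]; [apply: (dU (x, x)) | exact: dU].
Qed.

Lemma diagonal_nbhs_refl U x : diagonal_nbhs U -> U (x, x).
Proof. by move=> /diagonal_nbhsP/(_ x)/nbhs_singleton. Qed.

Lemma diagonal_nbhsI U V :
  diagonal_nbhs U -> diagonal_nbhs V -> diagonal_nbhs (U `&` V).
Proof.
move=> /diagonal_nbhsP dU /diagonal_nbhsP dV.
by apply/diagonal_nbhsP => x; apply: filterI.
Qed.

Lemma diagonal_nbhs_swap U :
  diagonal_nbhs U -> diagonal_nbhs [set p | U (p.2, p.1)].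
Proof.
move=> /diagonal_nbhsP dU; apply/diagonal_nbhsP => x.
have [[A B] [/= Ax Bx] AB] := dU x; exists (B, A) => // -[y z] [/= By Az].
exact: AB.
Qed.

Lemma diagonal_nbhs_section U x : diagonal_nbhs U -> nbhs x [set y | U (x, y)].
Proof.
move=> /diagonal_nbhsP/(_ x)[[A B] [/= Ax Bx] AB].
by apply: filterS Bx => y By; apply: AB; split => //=; exact: nbhs_singleton.
Qed.

Lemma fine_open_cover U : compact [set: X] -> diagonal_nbhs U ->
  exists2 beta : {fset (set X)}, finite_open_cover beta &
    forall B x y, B \in beta -> B x -> B y -> U (x, y).
Proof.
move=> cX /diagonal_nbhsP dU.
pose small (B : set X) := open B /\ forall x y, B x -> B y -> U (x, y).
apply: contrapT => nbeta.
pose S (b : {b : {fset (set X)} | forall B, B \in b -> small B}) :=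
  [set x | forall B, B \in sval b -> ~ B x].
have [||||x clS] := @compact_directed_adherent _ _ S => //.
- by split; exists fset0 => B; rewrite inE.
- move=> [b bsmall]; apply: contrapT => S0; apply: nbeta; exists b.
    split=> [B /bsmall[]//|]; apply/seteqP; split=> // x _.
    by apply: contrapT => nx; apply: S0; exists x => B bB Bx; apply: nx; exists B.
  by move=> B x y /bsmall[_]; apply.
- move=> [b bP] [c cP]; unshelve eexists.
    by exists (b `|` c)%fset => B; rewrite inE => /orP[/bP|/cP].
  by move=> x Sx; split=> B /= Bb; apply: Sx; rewrite /= inE Bb ?orbT.
have [[A B] [/= Ax Bx] AB] := dU x.
pose D := interior (A `&` B).
have Dsmall C : C \in [fset D]%fset -> small C.
  rewrite inE => /eqP ->; split; first exact: open_interior.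
  by move=> y z /interior_subset[Ay _] /interior_subset[_ Bz]; exact: AB.
have Dx : nbhs x D by apply/nbhs_interior/filterI.
have [y [/= Sy Dy]] := clS (exist _ _ Dsmall) _ Dx.
by apply: (Sy D) => //; rewrite inE.
Qed.

End DiagonalNbhs.

Lemma nbhs_setX (S T : topologicalType) (a : S) (b : T) (A : set S) (B : set T) :
  nbhs a A -> nbhs b B -> nbhs (a, b) (A `*` B).
Proof. by move=> aA bB; exists (A, B). Qed.

Section CompactHausdorff.
Variable X : topologicalType.
Hypotheses (cX : compact [set: X]) (hX : hausdorff_space X).
Implicit Types (U V W : set (X * X)) (x y z : X).

(** Regularity gives distinct points neighborhoods with disjoint closures; the complement of the
    product of these closures is an entourage that avoids a neighborhood of the pair. *)
Lemma closure_diagonal_nbhs_eq x y :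
  (forall V, diagonal_nbhs V -> closure V (x, y)) -> x = y.
Proof.
move=> clV; apply: contrapT => /eqP xy.
have regX z (A : set X) : nbhs z A -> exists2 B, nbhs z B & closure B `<=` A.
  by move=> zA; apply: (compact_regular hX cX _ zA); exact: filterT.
have := hX; rewrite open_hausdorff => /(_ _ _ xy)[[A B]] /=.
rewrite !inE => -[Ax By] [oA oB AB0].
have [A' A'x A'A] := regX x A (open_nbhs_nbhs (conj oA Ax)).
have [B' B'y B'B] := regX y B (open_nbhs_nbhs (conj oB By)).
have dV : diagonal_nbhs [set p | ~ (closure A' p.1 /\ closure B' p.2)].
  apply/diagonal_nbhsP => z; have [Az|nAz] := pselect (closure A' z).
    have nBz : ~ closure B' z.
      by move=> Bz; suff : (A `&` B) z; [rewrite AB0 | split; [exact: A'A | exact: B'B]].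
    exists (setT, ~` closure B') => /=; last by move=> p [_ /= np] [].
    split; first exact: filterT.
    by apply: open_nbhs_nbhs; split=> //; rewrite openC; exact: closed_closure.
  exists (~` closure A', setT) => /=; last by move=> p [/= np _] [].
  split; last exact: filterT.
  by apply: open_nbhs_nbhs; split=> //; rewrite openC; exact: closed_closure.
have [[u v] [/= nuv [A'u B'v]]] := clV _ dV _ (nbhs_setX A'x B'y).
by apply: nuv; split; exact: subset_closure.
Qed.

(** Otherwise triples violating the composition property accumulate at a triple which is constant by
    [closure_diagonal_nbhs_eq], and [U] holds near it. *)
Lemma diagonal_nbhs_half U : diagonal_nbhs U -> exists V, [/\ diagonal_nbhs V,
  forall x y, V (x, y) -> V (y, x) & forall x y z, V (x, y) -> V (y, z) -> U (x, z)].
Proof.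
move=> dU; suff [V dV VU] : exists2 V, diagonal_nbhs V &
    forall x y z, V (x, y) -> V (y, z) -> U (x, z).
  exists (V `&` [set p | V (p.2, p.1)]); split.
  - exact/diagonal_nbhsI/diagonal_nbhs_swap.
  - by move=> x y [].
  - by move=> x y z [xy _] [yz _]; exact: VU yz.
apply: contrapT => nV.
pose S (V : {V | diagonal_nbhs V}) :=
  [set p : X * X * X | [/\ sval V p.1, sval V (p.1.2, p.2) & ~ U (p.1.1, p.2)]].
have [| | | |[[x y] z] clS] := @compact_directed_adherent _ _ S.
- by rewrite -!setXTT; do 2! apply: compact_setX => //.
- by split; exists U.
- move=> [V dV]; apply: contrapT => S0; apply: nV; exists V => // x y z xy yz.
  by apply: contrapT => nxz; apply: S0; exists (x, y, z).
- move=> [V dV] [V' dV']; exists (exist _ _ (diagonal_nbhsI dV dV')).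
  by move=> p [/= [? ?] [? ?] ?]; split.
have nT (u : X) : nbhs u setT by exact: filterT.
have xy : x = y.
  apply: closure_diagonal_nbhs_eq => V dV B Bxy.
  have [[p q] [/= [Vp _ _] [Bp _]]] := clS (exist _ V dV) _
    (nbhs_setX Bxy (nT z)).
  by exists p.
have yz : y = z.
  apply: closure_diagonal_nbhs_eq => V dV B [[B1 B2] [/= B1y B2z] sB].
  have nb := nbhs_setX (nbhs_setX (nT x) B1y) B2z.
  have [[[p q] r] [/= [_ Vqr _] [[_ B1q] B2r]]] := clS (exist _ V dV) _ nb.
  by exists (q, r); split=> //; exact: sB.
rewrite -{}yz -{}xy in clS; have /diagonal_nbhsP/(_ x)[[A B] [/= Ax Bx] AB] := dU.
have nb := nbhs_setX (nbhs_setX Ax (nT x)) Bx.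
have [[[p q] r] [/= [_ _ nU] [[Ap _] Br]]] := clS (exist _ U dU) _ nb.
by apply: nU; exact: AB.
Qed.

Lemma Lebesgue_diagonal_nbhs (alpha : {fset (set X)}) : finite_open_cover alpha ->
  exists2 W, diagonal_nbhs W &
    forall x, exists2 A, A \in alpha & forall y, W (x, y) -> A y.
Proof.
move=> [oalpha calpha]; apply: contrapT => nW.
pose S (W : {W | diagonal_nbhs W}) :=
  [set x | forall A, A \in alpha -> exists2 y, sval W (x, y) & ~ A y].
have [||||x clS] := @compact_directed_adherent _ _ S => //.
- by split; exists setT; apply/diagonal_nbhsP => x; exact: filterT.
- move=> [W dW]; apply: contrapT => S0; apply: nW; exists W => // x.
  apply: contrapT => nA; apply: S0; exists x => A Aa; apply: contrapT => ny.
  by apply: nA; exists A => // y Wy; apply: contrapT => nAy; apply: ny; exists y.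
- move=> [V dV] [W dW]; exists (exist _ _ (diagonal_nbhsI dV dW)) => x Sx.
  by split=> A /Sx[y [Vxy Wxy] nA]; exists y.
have : [set: X] x by []; rewrite -calpha => -[A /= Aa Ax].
(* [U] only constrains pairs starting at [x]; it is an entourage because points are closed. *)
pose U := [set p : X * X | p.1 = x -> A p.2].
have dU : diagonal_nbhs U.
  apply/diagonal_nbhsP => z; have [->|/eqP zx] := pselect (z = x).
    exists (setT, A) => /=; last by move=> p [_ /= Ap] _.
    by split; [exact: filterT | apply: open_nbhs_nbhs; split=> //; exact: oalpha].
  exists (~` [set x], setT) => /=; last by move=> p [/= px _] /px.
  split; last exact: filterT.
  apply: open_nbhs_nbhs; split; last exact/eqP.
  by rewrite openC; apply: accessible_closed_set1; exact: hausdorff_accessible.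
have [W [dW _ WU]] := diagonal_nbhs_half dU.
have [y [/= Sy Wxy]] := clS (exist _ W dW) _ (diagonal_nbhs_section x dW).
by have [z Wyz] := Sy A Aa; apply; exact: (WU _ _ _ Wxy Wyz).
Qed.

End CompactHausdorff.

(** * Homoclinic points and comparison of entropies *)

Section Dynamics.
Variables (G : groupType) (X : topologicalType) (act : G -> X -> X).
Hypotheses (cX : compact [set: X]) (hX : hausdorff_space X).
Hypothesis actP : continuous_action act.
Implicit Types (U V W : set (X * X)) (x y z : X).

Lemma act_nbhs g x V : diagonal_nbhs V -> nbhs x [set y | V (act g x, act g y)].
Proof.
by case: actP => _ _ cact dV; exact: (cact g x _ (diagonal_nbhs_section (act g x) dV)).
Qed.

(** Otherwise pairs outside [W] that stay close along larger and larger [K] accumulate at two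
    distinct points that stay [U0]-close along all of [G]. Passing to the limit costs one [V] on
    each side. *)
Lemma expansive_finite : expansive act -> exists2 U, diagonal_nbhs U &
  forall W, diagonal_nbhs W -> exists K : {fset G},
    forall x y, (forall k, k \in K -> U (act k x, act k y)) -> W (x, y).
Proof.
move=> [U0 dU0 expU0].
have [V1 [dV1 sV1 V1U0]] := diagonal_nbhs_half cX hX dU0.
have [V [dV sV VV1]] := diagonal_nbhs_half cX hX dV1.
exists V => // W dW; apply: contrapT => nK.
pose S (K : {fset G}) := [set p : X * X | ~ W p /\
  forall k, k \in K -> V (act k p.1, act k p.2)].
have cXX : compact [set: X * X] by rewrite -setXTT; apply: compact_setX.
have [||[x y] clS] := @compact_directed_adherent _ _ S cXX (inhabits fset0).
- move=> K; apply: contrapT => S0; apply: nK; exists K => x y Vxy.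
  by apply: contrapT => nW; apply: S0; exists (x, y).
- move=> K L; exists (K `|` L)%fset => p [nW Vp].
  by split; split=> // k kK; apply: Vp; rewrite inE kK ?orbT.
have xy : x <> y.
  move=> xy; rewrite -{}xy in clS.
  by have [p [[nW _] Wp]] := clS fset0 _ ((diagonal_nbhsP W).1 dW x).
have [g] := expU0 x y xy; apply.
have [[x' y'] [[_ /= Vg] [/= Vx Vy]]] := clS [fset g]%fset _
  (nbhs_setX (act_nbhs g x dV) (act_nbhs g y dV)).
apply: V1U0 (VV1 _ _ _ Vx (Vg _ _)) _; first by rewrite inE.
by apply: VV1 (sV _ _ Vy) _; exact: diagonal_nbhs_refl.
Qed.

(** [F] is joined explicitly because [K] need not contain the identity. *)
Definition thicken (K F : {fset G}) : {fset G} :=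
  (F `|` \bigcup_(k <- K) ltrans k F)%fset.

Lemma mem_thicken K F k g : k \in K -> g \in F -> (k * g)%g \in thicken K F.
Proof.
move=> kK gF; rewrite inE; apply/orP; right; apply/bigfcupP; exists k.
  by rewrite kK.
by rewrite mem_ltrans mulKg.
Qed.

Lemma card_thickenD (R : realType) (K F : {fset G}) (d : R) : invariant K d F ->
  #|` (thicken K F `\` F)%fset|%:R <= #|` K|%:R * (d * #|` F|%:R).
Proof.
move=> [_ Finv]; have : (#|` (thicken K F `\` F)%fset|
    <= \sum_(k <- K) #|` (ltrans k F `\` F)%fset|)%N.
  apply: card_fset_le_sum => g; rewrite !inE => /andP[gF /orP[/(negP gF)//|]].
  move=> /bigfcupP[k]; rewrite andbT => kK kg.
  by exists k; rewrite // inE gF.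
rewrite -(ler_nat R) natr_sum => /le_trans; apply.
rewrite mulr_natl -iter_addr_0 -count_predT -big_const_seq.
by rewrite big_seq [leRHS]big_seq; apply: ler_sum.
Qed.

(* Weak specification only handles finite sets; compactness extends it to the
   complement of a thickening of [F]. *)
Lemma specification_cofinite U : weak_specification act -> diagonal_nbhs U ->
  exists K : {fset G}, forall (F : {fset G}) x x0, exists y,
    (forall g, g \in F -> U (act g y, act g x)) /\
    (forall g, g \notin thicken K F -> U (act g y, act g x0)).
Proof.
move=> spec dU; have [V [dV sV VU]] := diagonal_nbhs_half cX hX dU.
have [L LP] := spec V dV.
(* The inverses are included because specification asks for disjointness in both orders of the two
   sets. *)
exists (L `|` [fset l^-1%g | l in L])%fset => F x x0.
set K := (L `|` _)%fset.
pose S (O : {fset G}) := [set y |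
  (forall g, g \in F -> V (act g y, act g x)) /\
  (forall g, g \in O -> g \notin thicken K F -> V (act g y, act g x0))].
have [||y clS] := @compact_directed_adherent _ _ S cX (inhabits fset0).
(* Specification is applied to two sets, [F] with target [x] and the part of [O] outside the
   thickening with target [x0]. *)
- move=> O; have [|y yP] := LP 2%N (fun i => if i == ord0 then F else O `\` thicken K F)%fset
    (fun i => if i == ord0 then x else x0) isT.
    have disj g l : l \in L -> g \in F -> (l * g)%g \in (O `\` thicken K F)%fset -> False.
      move=> lL gF; rewrite inE => /andP[/negP nlg _]; apply: nlg.
      by apply: mem_thicken => //; rewrite /K inE lL.
    have disj' g l : l \in L -> g \in (O `\` thicken K F)%fset -> (l * g)%g \in F -> False.
      move=> lL gO lgF; have := @mem_thicken K F l^-1%g _ _ lgF.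
      move: gO; rewrite mulKg inE => /andP[/negP gK _] gK'; apply/gK/gK'.
      by rewrite /K inE; apply/orP; right; apply/imfsetP; exists l.
    move=> j k jk; apply/fsetP => g; rewrite in_fset0; apply/negP; rewrite inE.
    move=> /andP[gj /imfset2P[l /= lL [w /= wk gE]]].
    case: ifP gj => [/eqP j0|/negbT j0]; case: ifP wk => [/eqP k0|/negbT k0].
    + by move: jk; rewrite j0 k0 eqxx.
    + by rewrite gE => wO lwF; exact: disj' lL wO lwF.
    + by rewrite gE => wF lwO; exact: disj lL wF lwO.
    + by case: j k j0 k0 jk => [[|[|?]] ?] [[|[|?]] ?].
  exists y; split=> [g gF|g gO gF]; first exact: (yP ord0).
  by apply: (yP (@ord_max 1)); rewrite /= inE gF gO.
- move=> O O'; exists (O `|` O')%fset => z [zF zO].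
  by split; split=> // g gO; apply: zO; rewrite inE gO ?orbT.
exists y; split=> g gF.
  have [z [[zF _] Vyz]] := clS fset0 _ (act_nbhs g y dV).
  exact: VU Vyz (zF _ gF).
have [z [[_ zO] Vyz]] := clS [fset g]%fset _ (act_nbhs g y dV).
by apply: VU Vyz (zO _ _ gF); rewrite inE.
Qed.

(** [W]-closeness at [g] only needs [U]-closeness along [K g], and [K g] misses [E] for all but
    finitely many [g]. *)
Lemma cofinite_homoclinic U (E : {fset G}) x y :
  (forall W, diagonal_nbhs W -> exists K : {fset G},
    forall x y, (forall k, k \in K -> U (act k x, act k y)) -> W (x, y)) ->
  (forall g, g \notin E -> U (act g x, act g y)) -> homoclinic act x y.
Proof.
move=> expU UE W dW; have [K KP] := expU W dW.
exists (\bigcup_(k <- K) ltrans k^-1%g E)%fset => g gK; apply: KP => k kK.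
case: actP => _ actM _; rewrite -!actM; apply: UE; apply: contra gK => kgE.
by apply/bigfcupP; exists k; rewrite ?kK// mem_ltrans invgK.
Qed.

(* Greedily, as long as there are fewer than [Ncov act alpha F] points their
   [W]-neighbourhoods along [F] do not cover [X]. *)
Lemma separated_points (alpha : {fset (set X)}) W (F : {fset G}) :
  finite_open_cover alpha -> diagonal_nbhs W ->
  (forall x, exists2 A, A \in alpha & forall y, W (x, y) -> A y) ->
  exists s : seq X, size s = Ncov act alpha F /\
    pairwise (fun y x => `[< exists2 g, g \in F & ~ W (act g x, act g y) >]) s.
Proof.
move=> aP dW AW.
have /choice[A AP] : forall x, exists A, A \in alpha /\ forall y, W (x, y) -> A y.
  by move=> x; have [A] := AW x; exists A.
suff H n : (n <= Ncov act alpha F)%N -> exists s : seq X, size s = n /\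
    pairwise (fun y x => `[< exists2 g, g \in F & ~ W (act g x, act g y) >]) s.
  by exact: H.
elim: n => [|n IHn] nN; first by exists [::].
have [s [sn sP]] := IHn (ltnW nN).
have [z zP] : exists z, forall x, x \in s ->
    exists2 g, g \in F & ~ W (act g x, act g z).
  apply: contrapT => nz.
  (* If every point were [W]-close along [F] to some [x] in [s], the members of [alpha] chosen along
     the orbits of [s] would form too small a subcover family. *)
  suff : (Ncov act alpha F <= #|'I_(size s)|)%N by rewrite card_ord sn leqNgt nN.
  apply: (@Ncov_le _ _ _ actP alpha _ (fun i g => A (act g (tnth (in_tuple s) i)))).
  split=> [i g _|z]; first by case: (AP (act g (tnth (in_tuple s) i))).
  have [x xs xz] : exists2 x, x \in s & forall g, g \in F -> W (act g x, act g z).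
    apply: contrapT => nx; apply: nz; exists z => x xs; apply: contrapT => ng.
    apply: nx; exists x => // g gF; apply: contrapT => nW; apply: ng; by exists g.
  have /tnthP[i iE] : x \in in_tuple s by [].
  by exists i => g gF; rewrite -iE; apply: (AP _).2; exact: xz.
exists (z :: s); split=> /=; first by rewrite sn.
by rewrite sP andbT; apply/allP => x xs; apply/asboolP; exact: zP.
Qed.

End Dynamics.

(** * From counting inequalities to inequalities of entropy *)

Section Comparison.
Variables (R : realType) (G : groupType) (X Y : topologicalType).
Variables (actX : G -> X -> X) (actY : G -> Y -> Y).
Hypotheses (actXP : continuous_action actX) (actYP : continuous_action actY).

Lemma htop_cover_le (alpha : {fset (set X)}) (beta : {fset (set Y)})
    (K : {fset G}) (C : R) :
  amenable R G -> finite_open_cover alpha -> finite_open_cover beta -> 0 <= C ->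
  (forall F, hcov R actX alpha F <=
     hcov R actY beta F + C * #|` (thicken K F `\` F)%fset|%:R) ->
  htop_cover actX R alpha <= htop_cover actY R beta.
Proof.
move=> amG aP bP C0 le_h; apply/ler_addgt0Pr => e e0.
have e30 : 0 < e / 3 by rewrite divr_gt0.
have [KX [dX [dX0 XP]]] := htop_cover_invariant actXP aP amG e30.
have [KY [dY [dY0 YP]]] := htop_cover_invariant actYP bP amG e30.
(* On such sets the thickening costs at most [e / 3] per point; adding 1 keeps the denominator
   positive. *)
pose dK := e / 3 / (C * #|` K|%:R + 1).
have CK0 : 0 < C * #|` K|%:R + 1 by rewrite ltr_wpDl// mulr_ge0.
have dK0 : 0 < dK by rewrite divr_gt0.
have [|F Finv] := amenable_invariant (K `|` (KX `|` KY))%fset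
    (_ : 0 < Num.min dK (Num.min dX dY)) amG.
  by rewrite !lt_min dK0 dX0.
have [F0 _] := Finv; have f0 : (0 : R) < #|` F|%:R by rewrite ltr0n cardfs_gt0.
have /XP : invariant KX dX F.
  apply: invariantS Finv; first by apply/fsubsetP => k; rewrite !inE => ->; rewrite orbT.
  by rewrite !ge_min lexx !orbT.
have /YP : invariant KY dY F.
  apply: invariantS Finv; first by apply/fsubsetP => k; rewrite !inE => ->; rewrite !orbT.
  by rewrite !ge_min lexx !orbT.
have /card_thickenD : invariant K dK F.
  by apply: invariantS Finv; [exact: fsubsetUl | rewrite ge_min lexx].
rewrite !ler_distl !ler_pdivlMr// !ler_pdivrMr// => Kd /andP[_ hY] /andP[hX _].
rewrite -(ler_pM2r f0); have := le_h F.
have : C * #|` (thicken K F `\` F)%fset|%:R <= e / 3 * #|` F|%:R.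
  apply: le_trans (ler_wpM2l C0 Kd) _; rewrite mulrA mulrA ler_wpM2r ?ltW//.
  have : (C * #|` K|%:R + 1) * dK = e / 3 by rewrite mulrC divfK// gt_eqF.
  lra.
lra.
Qed.

End Comparison.

(** Pigeonhole: two points with the same index share a member of [beta] at every [g] in [F], hence
    are [V]-close along [F]. *)
Lemma separated_le_Ncov (G : groupType) (Y : topologicalType)
    (act : G -> Y -> Y) (beta : {fset (set Y)}) (V : set (Y * Y))
    (F : {fset G}) (s : seq Y) :
  continuous_action act -> finite_open_cover beta ->
  (forall B x y, B \in beta -> B x -> B y -> V (x, y)) ->
  pairwise (fun y x => `[< exists2 g, g \in F & ~ V (act g x, act g y) >]) s ->
  (size s <= Ncov act beta F)%N.
Proof.
move=> actP bP Vfine sP; have [a [ab /choice[c cP]]] := Ncov_family actP bP F.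
have /card_uniqP cs : uniq (map c s).
  rewrite uniq_pairwise pairwise_map; apply: sub_pairwise sP => y x /asboolP[g gF nV] /=.
  apply/negP => /eqP cyx; apply: nV.
  by apply: (Vfine (a (c x) g)); [exact: ab | exact: cP | rewrite -cyx; exact: cP].
by rewrite -(size_map c) -cs (leq_trans (max_card _))// card_ord.
Qed.

Lemma hcov_le_of_inj (R : realType) (G : groupType) (X Y : topologicalType)
    (actX : G -> X -> X) (actY : G -> Y -> Y) (f : X -> Y)
    (alpha : {fset (set X)}) (x0 : X) :
  compact [set: X] -> hausdorff_space X ->
  compact [set: Y] -> hausdorff_space Y ->
  continuous_action actX -> continuous_action actY ->
  expansive actX -> expansive actY -> weak_specification actX ->
  continuous f -> (forall g x, f (actX g x) = actY g (f x)) ->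
  set_inj (homoclinicity_class actX x0) f -> finite_open_cover alpha ->
  exists (beta : {fset (set Y)}) (K : {fset G}), finite_open_cover beta /\
    forall F, hcov R actX alpha F <=
      hcov R actY beta F + ln #|` beta|%:R * #|` (thicken K F `\` F)%fset|%:R.
Proof.
move=> cX hX cY hY actXP actYP expX [V0 dV0 expV0] spec cf feq finj aP.
have [U1 dU1 U1P] := expansive_finite cX hX actXP expX.
have [W dW WA] := Lebesgue_diagonal_nbhs cX hX aP.
have [U2 [dU2 sU2 U2W]] := diagonal_nbhs_half cX hX dW.
have [V1 [dV1 sV1 V1V0]] := diagonal_nbhs_half cY hY dV0.
have dU3 : diagonal_nbhs [set p : X * X | V1 (f p.1, f p.2)].
  apply/diagonal_nbhsP => x; have /diagonal_nbhsP/(_ (f x))[[A B] [/= Ax Bx] AB] := dV1.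
  exists (f @^-1` A, f @^-1` B) => /=; first by split; exact: cf.
  by move=> p [/= Ap Bp]; exact: AB.
(* The three conditions serve, in order, homoclinicity to [x0], separation in [X], and closeness of
   the images to [f x0]. *)
have dU := diagonal_nbhsI (diagonal_nbhs_swap dU1) (diagonal_nbhsI dU2 dU3).
have [K KP] := specification_cofinite cX hX actXP spec dU.
have [beta bP bV0] := fine_open_cover cY dV0.
exists beta, K; split=> // F.
have /choice[p pP] := fun x => KP F x x0.
have [s [sN sP]] := separated_points actXP F aP dW WA.
have p_class x : homoclinicity_class actX x0 (p x).
  apply: (cofinite_homoclinic actXP U1P (E := thicken K F)) => g gF.
  by case: (pP x) => _ /(_ g gF)[].
have N_le : (Ncov actX alpha F <= Ncov actY beta (thicken K F))%N.
  rewrite -sN -(size_map (f \o p)); apply: separated_le_Ncov bV0 _ => //.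
  rewrite pairwise_map; apply: sub_pairwise sP => y x /asboolP[g gF nW].
  (* Equal images would force [p x = p y], a single point following both [x] and [y] along [F],
     against their separation. *)
  have pxy : f (p x) <> f (p y).
    move=> /(finj _ _ (mem_set (p_class x)) (mem_set (p_class y))) pxy.
    have [/(_ g gF)[_ [xU _]] _] := pP x; have [/(_ g gF)[_ [yU _]] _] := pP y.
    by apply: nW; apply: U2W (sU2 _ _ xU) _; rewrite pxy.
  (* Off the thickening both images are [V1]-close to the orbit of [f x0], so a separating [k] must
     lie in it. *)
  have [k nV0] := expV0 _ _ pxy; apply/asboolP; exists k => //.
  apply: contrapT => /negP kF; apply: nV0.
  have [_ /(_ k kF)[_ [_ xV]]] := pP x; have [_ /(_ k kF)[_ [_ yV]]] := pP y.
  by move: xV yV; rewrite /= !feq => xV /sV1; exact: V1V0.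
apply: le_trans (ln_nat_le R N_le) _.
have thE : (F `|` (thicken K F `\` F))%fset = thicken K F.
  by rewrite fsetUDl fsetDv fsetD0; apply/fsetUidPr; exact: fsubsetUl.
have := hcovU R actYP bP F (thicken K F `\` F)%fset; rewrite thE => /le_trans; apply.
by rewrite lerD2l; exact: hcov_lin.
Qed.

Theorem theorem7p2 (R : realType) (G : groupType) (X Y : topologicalType)
    (actX : G -> X -> X) (actY : G -> Y -> Y) (f : X -> Y) :
  amenable R G ->
  compact [set: X] -> hausdorff_space X ->
  compact [set: Y] -> hausdorff_space Y ->
  continuous_action actX -> continuous_action actY ->
  expansive actX -> expansive actY ->
  weak_specification actX ->
  (htop actY R < htop actX R)%E ->
  continuous f ->
  (forall g x, f (actX g x) = actY g (f x)) ->
  ~ pre_injective actX f /\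
  (forall x : X, ~ set_inj (homoclinicity_class actX x) f).
Proof.
move=> amG cX hX cY hY actXP actYP expX expY spec htop_lt cf feq.
have htop_cover_gt : exists2 alpha : {fset (set X)}, finite_open_cover alpha &
    forall beta : {fset (set Y)}, finite_open_cover beta ->
    htop_cover actY R beta < htop_cover actX R alpha.
  apply: contrapT => nalpha; move: htop_lt; rewrite ltNge => /negP; apply.
  apply: ge_ereal_sup => _ [alpha aP <-].
  have [beta bP le_ab] : exists2 beta : {fset (set Y)}, finite_open_cover beta &
      htop_cover actX R alpha <= htop_cover actY R beta.
    apply: contrapT => nbeta; apply: nalpha; exists alpha => // beta bP.
    by rewrite ltNge; apply/negP => le_ab; apply: nbeta; exists beta.
  by apply: le_trans (_ : (htop_cover actY R beta)%:E <= _)%E;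
    [rewrite lee_fin | apply: ereal_sup_ubound; exists beta].
have [alpha aP lt_ba] := htop_cover_gt.
have not_inj x : ~ set_inj (homoclinicity_class actX x) f.
  move=> finj; have [beta [K [bP le_h]]] := hcov_le_of_inj R cX hX cY hY actXP actYP
    expX expY spec cf feq finj aP.
  have := lt_ba beta bP; rewrite ltNge => /negP; apply.
  apply: htop_cover_le amG aP bP _ le_h => //.
  exact: ln_nat_ge0.
split=> // preinj; have [x|noX] := pselect (inhabited X).
  by case: x => x; exact: not_inj (preinj x).
(* Without a point of [X] no homoclinicity class is available. Here [X] is empty, [alpha]
   contributes 0, and the trivial cover of [Y] contradicts the strict inequality. *)
have bP : finite_open_cover [fset [set: Y]]%fset.
  split=> [B|]; first by rewrite inE => /eqP ->; exact: openT.
  by apply/seteqP; split=> // y _; exists setT; rewrite //= inE.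
have := lt_ba _ bP; rewrite ltNge => /negP; apply.
apply: (@htop_cover_le _ _ _ _ _ _ actXP actYP _ _ fset0 0) => // F.
rewrite mul0r addr0 (le_trans _ (hcov_ge0 _ _ _ _))//.
have : (Ncov actX alpha F <= #|{: void}|)%N.
  apply: (@Ncov_le _ _ _ actXP alpha void (fun i _ => setT)); split=> [[]|x].
  by case: noX.
by rewrite card_void leqn0 /hcov => /eqP ->; rewrite ln0.
Qed.
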